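(* For every nonnegative integer $d$ there exists a constant $C_d>0$, depending only on $d$, such that the following holds. Let $n\ge d$ ($n \geq 1$) and $r\ge 0$ be integers, and let $f\in\mathbb{R}[x_1,\dots,x_n]$ be a polynomial of degree $d$ that is not identically zero on $\{0,1\}^n$. If $(r+1)/n\le 1/2$ and $d(d+1)\cdot \xi^n_{r+1}/n\le 1/2$, then $$\frac{f_{\min}-f_{(r)}}{\|f\|_\infty}\le 2C_d\cdot \xi^n_{r+1}/n .$$
   Context: Write $\mathbb{B}^n=\{0,1\}^n$, $f_{\min}=\min_{x\in\mathbb{B}^n}f(x)$ and $\|f\|_\infty=\max_{x\in\mathbb{B}^n}|f(x)|$. $\Sigma_r$ denotes the set of sum-of-squares polynomials of degree at most $2r$, i.e. finite sums $\sum_i p_i^2$ with $p_i\in\mathbb{R}[x]$ of degree at most $r$. The sum-of-squares (outer Lasserre) lower bound of order $r$ is $$f_{(r)}:=\sup\{\lambda\in\mathbb{R}: \text{there is } s\in\Sigma_r \text{ with } f(x)-\lambda=s(x) \text{ for all } x\in\mathbb{B}^n\}.$$ The Krawtchouk polynomial of degree $k$ with parameter $n$ is the univariate polynomial $\mathcal{K}^n_k(t)=\sum_{i=0}^k(-1)^i\binom{t}{i}\binom{n-t}{k-i}$. For $1\le k\le n$, $\xi^n_k$ denotes its least (smallest real) root. *)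

(* Defs.v *)
From mathcomp Require Import all_boot all_order all_algebra.
(* mpoly has to be imported before MathComp-Analysis: in the other order their
   notation levels clash. *)
From mathcomp Require Import mpoly.
From mathcomp Require Import boolp classical_sets reals constructive_ereal ereal.

Set Implicit Arguments.
Unset Strict Implicit.
Unset Printing Implicit Defensive.

Import Order.TTheory GRing.Theory Num.Theory.
Local Open Scope classical_set_scope.
Local Open Scope ring_scope.

Definition cube (n : nat) := {ffun 'I_n -> bool}.

Section CubeOptimization.
Variables (R : realType) (n : nat).
Implicit Types f q : {mpoly R[n]}.

Definition cube_eval f (x : cube n) : R := f.@[fun i => (x i)%:R].

(* The seed of the iterated minimum is the value at the origin, itself a point
   of the cube. *)
Definition cube_min f : R :=
  \big[Num.min/cube_eval f [ffun=> false]]_(x : cube n) cube_eval f x.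

Definition cube_norm f : R := \big[Num.max/0]_(x : cube n) `|cube_eval f x|.

(* msize is the total degree plus one, so [msize p <= r.+1] reads deg p <= r
   (and the zero polynomial is allowed). *)
Definition sos (r : nat) q : Prop :=
  exists2 s : seq {mpoly R[n]},
    (forall p, p \in s -> (msize p <= r.+1)%N) & q = \sum_(p <- s) p ^+ 2.

(* The supremum is taken in the extended reals, so that an infeasible program
   has value -oo. *)
Definition sos_bound (r : nat) f : \bar R :=
  ereal_sup [set lambda%:E | lambda in
    [set lambda : R | exists2 s : {mpoly R[n]}, sos r s &
                        forall x : cube n, cube_eval f x - lambda = cube_eval s x]].

End CubeOptimization.

Section Krawtchouk.
Variable R : realType.

(* The binomial coefficient p (p - 1) ... (p - i + 1) / i! of a polynomial p. *)
Definition poly_binom (p : {poly R}) (i : nat) : {poly R} :=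
  (i`!%:R)^-1 *: \prod_(j < i) (p - j%:R%:P).

Definition krawtchouk (n k : nat) : {poly R} :=
  \sum_(i < k.+1)
     (-1) ^+ i *: (poly_binom 'X i * poly_binom (n%:R%:P - 'X) (k - i)).

(* The default value 0 is only reached when p has no least real root. *)
Definition least_root (p : {poly R}) : R :=
  xget 0 [set t | root p t /\ forall u, root p u -> t <= u].

Definition krawtchouk_root (n k : nat) : R := least_root (krawtchouk n k).

End Krawtchouk.

(* Main.v *)
Require Import Defs.
From mathcomp Require Import all_boot all_order all_algebra.
From mathcomp Require Import mpoly.
From mathcomp Require Import boolp classical_sets reals constructive_ereal ereal.
From mathcomp Require Import ring lra zify.

(** Averaging against the kernel [w (x + y)], where [w z = u (|z|) ^ 2] is a
    probability on the cube and [deg u <= r], maps nonnegative functions to sums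
    of squares of degree at most [2 r], and multiplies the component of degree
    [k] of a function by an eigenvalue [lam k]. Taking [u = K / (X - xi)], with
    [K] the Krawtchouk polynomial of degree [r + 1] and [xi] its least root, the
    orthogonality of [K] to [u] makes the mean weight under [w] equal to [xi],
    whence [0 <= 1 - lam k <= 2 k xi / n]. The components of degree at most [d]
    of [f] are bounded by a multiple of [f] independent of [n], because at a
    point [x] they are the coefficients of a polynomial in [t], the noise
    operator of parameter [t] applied to [f] at [x], which is bounded on
    [-1, 1]. So the preimage of [f] under the kernel is within
    [O (xi / n) * |f|] of [f]: it becomes nonnegative once [f_min] minus this
    error has been subtracted, and its image is then a sum of squares. *)

Set Implicit Arguments.
Unset Strict Implicit.
Unset Printing Implicit Defensive.

Import Order.TTheory GRing.Theory Num.Theory.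
Local Open Scope ring_scope.

(** * Characters of the cube as the group [(Z/2)^n], and degree as a condition on frequencies *)

Section Fourier.
Variables (R : realType) (n : nat).
Implicit Types (a b x y z : cube n) (F G : cube n -> R).

Definition weight a : nat := \sum_i a i.

Definition cadd x y : cube n := [ffun i => x i (+) y i].

Definition chi a z : R := \prod_i (-1) ^+ (a i && z i).

Lemma weight_le a : (weight a <= n)%N.
Proof.
rewrite -[leqRHS]card_ord -sum1_card; apply: leq_sum => i _; exact: leq_b1.
Qed.

Lemma weight0 : weight [ffun=> false] = 0%N.
Proof. by apply: big1 => i _; rewrite ffunE. Qed.

Lemma caddK x : involutive (cadd x).
Proof. by move=> y; apply/ffunP => i; rewrite !ffunE addKb. Qed.

Lemma sum_cadd (T : nmodType) (F : cube n -> T) x :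
  \sum_y F (cadd x y) = \sum_y F y.
Proof.
by rewrite [RHS](reindex_inj (inv_inj (caddK x))).
Qed.

Lemma chiC a z : chi a z = chi z a.
Proof. by apply: eq_bigr => i _; rewrite andbC. Qed.

Lemma chiDr a x y : chi a (cadd x y) = chi a x * chi a y.
Proof.
rewrite -big_split; apply: eq_bigr => i _; rewrite /= ffunE -signr_addb.
by case: (a i).
Qed.

Lemma chiDl a b z : chi (cadd a b) z = chi a z * chi b z.
Proof. by rewrite !(chiC _ z) chiDr. Qed.

Lemma normr_chi a z : `|chi a z| = 1.
Proof.
by rewrite normr_prod big1 // => i _; rewrite normrX normrN1 expr1n.
Qed.

Lemma chi_le1 a z : chi a z <= 1.
Proof. by apply: le_trans (ler_norm _) _; rewrite normr_chi. Qed.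

Definition delta (i : 'I_n) : cube n := [ffun j => j == i].

Lemma chi_delta i z : chi (delta i) z = (-1) ^+ z i.
Proof.
rewrite /chi (bigD1 i) //= ffunE eqxx big1 ?mulr1 // => j /negPf ji.
by rewrite ffunE ji.
Qed.

Lemma weight_delta i : weight (delta i) = 1%N.
Proof.
rewrite /weight (bigD1 i) //= ffunE eqxx big1 // => j /negPf ji.
by rewrite ffunE ji.
Qed.

(** Each coordinate sums to [(1 + r) + (1 - r) = 2]. For [|r| <= 1] the product divided by [2 ^+ n]
    is thus a probability density, that of noise around [x]. *)
Lemma sum_noise (r : R) x :
  \sum_(z : cube n) \prod_i (1 + r * (-1) ^+ (x i (+) z i)) = 2 ^+ n.
Proof.
rewrite -(bigA_distr_bigA (fun i (c : bool) => 1 + r * (-1) ^+ (x i (+) c))).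
rewrite (eq_bigr (fun=> 2)) ?prodr_const ?card_ord // => i _.
by rewrite big_bool; case: (x i) => /=; rewrite ?expr0 ?expr1; ring.
Qed.

Lemma noise_chi (r : R) x y :
  \prod_i (1 + r * (-1) ^+ (x i (+) y i)) =
  \sum_a r ^+ weight a * (chi a x * chi a y).
Proof.
transitivity (\prod_i \sum_(c : bool) r ^+ c * (-1) ^+ (c && (x i (+) y i))).
  apply: eq_bigr => i _; rewrite big_bool /= expr1 expr0 mulr1.
  by rewrite addrC.
rewrite bigA_distr_bigA; apply: eq_bigr => a _.
rewrite -chiDr -prodrXr -big_split; apply: eq_bigr => i _ /=.
by rewrite ffunE.
Qed.

(** The sum factors over coordinates: those in [a] give [1 - 'X], the others [1 + 'X]. Hence a
    character sum over a level of the cube depends on [a] only through its weight. *)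
Lemma sum_Xn_chi a :
  \sum_z 'X^(weight z) * (chi a z)%:P =
  (1 - 'X) ^+ weight a * (1 + 'X) ^+ (n - weight a) :> {poly R}.
Proof.
transitivity
  (\prod_i \sum_(c : bool) ('X^c * ((-1) ^+ (a i && c))%:P : {poly R})).
  rewrite bigA_distr_bigA; apply: eq_bigr => z _.
  rewrite -prodrXr /chi rmorph_prod -big_split; exact: eq_bigr.
transitivity (\prod_i ((1 - 'X) ^+ a i * (1 + 'X) ^+ (~~ a i)) : {poly R}).
  apply: eq_bigr => i _; rewrite big_bool /= andbF andbT.
  by case: (a i); rewrite /= ?expr0 ?expr1 ?polyCN ?polyC1; ring.
rewrite big_split !prodrXr /=; congr (_ * _ ^+ _).
rewrite /weight -[X in (X - _)%N]card_ord -sum1_card -sumnB; last first.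
  by move=> i _; exact: leq_b1.
by apply: eq_bigr => i _; case: (a i).
Qed.

Lemma sum_chi_weight a k :
  \sum_(z | weight z == k) chi a z =
  ((1 - 'X) ^+ weight a * (1 + 'X) ^+ (n - weight a) : {poly R})`_k.
Proof.
rewrite -sum_Xn_chi coef_sum big_mkcond; apply: eq_bigr => z _.
by rewrite coefMC coefXn eq_sym; case: eqP; rewrite ?mul1r ?mul0r.
Qed.

(* By Fourier inversion, F agrees on the cube with a polynomial of degree at
   most m. *)
Definition degle m F :=
  forall a, (m < weight a)%N -> \sum_(z : cube n) F z * chi a z = 0.

Lemma degle_sum (I : Type) (s : seq I) (F : I -> cube n -> R) m :
  (forall i, degle m (F i)) -> degle m (fun z => \sum_(i <- s) F i z).
Proof.
move=> dF a ma; under eq_bigr do rewrite mulr_suml.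
by rewrite exchange_big big1 // => i _; exact: dF.
Qed.

Lemma degleZ c F m : degle m F -> degle m (fun z => c * F z).
Proof.
move=> dF a ma; under eq_bigr do rewrite -mulrA.
by rewrite -mulr_sumr dF ?mulr0.
Qed.

Lemma degleW F m m' : (m <= m')%N -> degle m F -> degle m' F.
Proof. by move=> mm' dF a ma; apply/dF/(leq_ltn_trans mm'). Qed.

Lemma weight_cadd_delta a i : (weight a <= (weight (cadd a (delta i))).+1)%N.
Proof.
rewrite /weight [leqLHS](bigD1 i) //= [in leqRHS](bigD1 i) //= -addnS.
apply: leq_trans (leq_addl _ _).
rewrite addnC -addn1 leq_add ?leq_b1 //; apply/leq_sum => j /negPf ji.
by rewrite !ffunE ji addbF.
Qed.

Lemma degle_const c : degle 0 (fun=> c).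
Proof.
move=> a a0; rewrite -mulr_sumr.
have [i ai] : exists i, a i.
  apply/existsP; apply: contraLR a0 => /existsPn a0.
  by rewrite -leqNgt leqn0 /weight big1 // => i _; rewrite (negPf (a0 i)).
(* Translation by [delta i] flips the sign of [chi a] since [a i] holds, so the sum is its own
   opposite. *)
suff s0 : \sum_z chi a z = - \sum_z chi a z.
  by rewrite [S in c * S](_ : _ = 0) ?mulr0 //; lra.
rewrite -[LHS](sum_cadd _ (delta i)) -sumrN; apply: eq_bigr => z _.
by rewrite chiDr (chiC a) chi_delta ai mulN1r.
Qed.

Lemma bit_chi i z : (z i)%:R = (1 - chi (delta i) z) / 2.
Proof. by rewrite chi_delta; case: (z i); rewrite /= ?expr0 ?expr1; field. Qed.

(** A bit is affine in [chi (delta i)], and multiplying by this character shifts frequencies by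
    [delta i], which lowers a weight by at most one. *)
Lemma degleM_bit i F m : degle m F -> degle m.+1 (fun z => (z i)%:R * F z).
Proof.
move=> dF a ma.
under eq_bigr => z _.
  rewrite bit_chi (_ : _ * _ * _ = F z * chi a z / 2 -
    F z * (chi a z * chi (delta i) z) / 2); last by ring.
  rewrite -chiDl.
  over.
have mai : (m < weight (cadd a (delta i)))%N.
  by rewrite -ltnS (leq_trans ma) // weight_cadd_delta.
by rewrite sumrB -!mulr_suml (dF _ (ltnW ma)) (dF _ mai) !mul0r subrr.
Qed.

Lemma degleM_weight F m :
  degle m F -> degle m.+1 (fun z => (weight z)%:R * F z).
Proof.
move=> dF; have := @degle_sum _ (index_enum 'I_n) (fun i z => (z i)%:R * F z) m.+1.
move=> /(_ (fun i => degleM_bit i dF)) dG a ma; rewrite -{}[RHS](dG a ma).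
by apply: eq_bigr => z _; rewrite -mulr_suml -natr_sum.
Qed.

Lemma degle_ext F G m : F =1 G -> degle m F -> degle m G.
Proof.
by move=> FG dF a ma; rewrite -[RHS](dF a ma); apply: eq_bigr => z _; rewrite FG.
Qed.

Lemma degle_poly (p : {poly R}) m :
  (size p <= m.+1)%N -> degle m (fun z => p.[(weight z)%:R]).
Proof.
move=> pm.
apply: (@degle_ext (fun z => \sum_(j <- index_enum 'I_(size p))
   p`_j * (weight z)%:R ^+ j)) => [z|].
  by rewrite horner_coef.
apply: degle_sum => j; apply/degleZ/(@degleW _ j).
  by rewrite -ltnS (leq_trans (ltn_ord j)).
elim: (nat_of_ord j) => [|k IHk].
  by apply: degle_ext (degle_const 1) => z; rewrite expr0.
by apply: degle_ext (degleM_weight IHk) => z; rewrite exprS.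
Qed.

Lemma degle_cube_eval (f : {mpoly R[n]}) m :
  (msize f <= m.+1)%N -> degle m (cube_eval f).
Proof.
move=> fm.
(* [degle_sum] wants the bound at every index, even outside the support; the conditional provides it
   there and changes nothing on the support. *)
apply: (@degle_ext (fun z => \sum_(u <- msupp f)
   (if (mdeg u <= m)%N then f@_u else 0) * \prod_i (z i)%:R ^+ u i)) => [z|].
  rewrite /cube_eval mevalE big_seq_cond [RHS]big_seq_cond.
  apply: eq_bigr => u; rewrite andbT => /msize_mdeg_lt uf.
  by rewrite -ltnS (leq_trans uf).
apply: degle_sum => u; case: ifP => um; last first.
  by apply: degle_ext (degleW (leq0n m) (degle_const 0)) => z; rewrite mul0r.
apply/degleZ/(degleW um); rewrite mdegE.
elim: (index_enum _) => [|i s IHs].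
  by rewrite big_nil; apply: degle_ext (degle_const 1) => z; rewrite big_nil.
apply: (@degle_ext (fun z => (z i)%:R ^+ u i * \prod_(j <- s) (z j)%:R ^+ u j)).
  by move=> z; rewrite big_cons.
rewrite big_cons; elim: (u i) => [|k IHk].
  by apply: degle_ext IHs => z; rewrite expr0 mul1r.
by apply: degle_ext (degleM_bit i IHk) => z; rewrite exprS mulrA.
Qed.

End Fourier.

(** * Krawtchouk polynomials and their least root *)

Section KrawtchoukRoot.
Variable R : realType.
Implicit Types p q u : {poly R}.

(** Induction on the size: divide by ['X - x], then compare [x] with the least root of the quotient,
    if the latter has a root. *)
Lemma ex_least_root p x :
  p != 0 -> root p x -> exists t, root p t /\ forall s, root p s -> t <= s.
Proof.
elim: {p}(size p) {-2}p (leqnn (size p)) x => [|m IHm] p.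
  by rewrite leqn0 size_poly_eq0 => ->.
move=> pm x p0 /factor_theorem[q pq].
have q0 : q != 0 by apply: contraNneq p0 => q0; rewrite pq q0 mul0r.
have rp s : root p s = root q s || (s == x).
  by rewrite pq rootM root_XsubC.
have qm : (size q <= m)%N.
  by move: pm; rewrite pq size_Mmonic ?monicXsubC // size_XsubC addn2.
have [[y qy]|nq] := pselect (exists y, root q y); last first.
  exists x; split=> [|s]; first by rewrite rp eqxx orbT.
  by rewrite rp => /orP[qs|/eqP->//]; case: nq; exists s.
have [t [qt tmin]] := IHm q qm y q0 qy.
exists (Num.min x t); split=> [|s].
  by rewrite rp; case: leP => _; rewrite ?eqxx ?orbT ?qt.
by rewrite rp ge_min => /orP[/tmin->|/eqP->]; rewrite ?lexx ?orbT.
Qed.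

Lemma root_least_root p x : p != 0 -> root p x -> root p (least_root p).
Proof. by move=> p0 /(ex_least_root p0) /(xgetPex 0) []. Qed.

Lemma size_poly_binom p i :
  (size p <= 2)%N -> (size (poly_binom p i) <= i.+1)%N.
Proof.
move=> p2; apply: leq_trans (size_scale_leq _ _) _.
elim: i => [|i IHi]; first by rewrite big_ord0 size_poly1.
rewrite big_ord_recr; apply: leq_trans (size_polyMleq _ _) _ => /=.
have s2 : (size (p - i%:R%:P)%R <= 2)%N.
  rewrite (leq_trans (size_polyD _ _)) // size_polyN geq_max p2.
  by rewrite (leq_trans (size_polyC_leq1 _)).
by rewrite -subn1 leq_subLR add1n -addn2 leq_add.
Qed.

Lemma horner_poly_binom p x m i :
  p.[x] = m%:R -> (poly_binom p i).[x] = 'C(m, i)%:R.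
Proof.
move=> px; rewrite /poly_binom hornerZ.
suff -> : (\prod_(j < i) (p - j%:R%:P)).[x] = (m ^_ i)%:R.
  by rewrite -bin_ffact natrM mulrC mulfK // pnatr_eq0 -lt0n fact_gt0.
elim: i => [|i IHi]; first by rewrite big_ord0 hornerC.
rewrite big_ord_recr hornerM IHi ffactnSr natrM !hornerE px.
have [im|mi] := leqP i m; first by rewrite natrB.
by rewrite ffact_small // !mul0r.
Qed.

Lemma size_krawtchouk n k : (size (krawtchouk R n k) <= k.+1)%N.
Proof.
apply: leq_trans (size_sum _ _ _) _; apply/bigmax_leqP => i _.
apply: leq_trans (size_scale_leq _ _) _.
apply: leq_trans (size_polyMleq _ _) _.
have := @size_poly_binom 'X i; rewrite size_polyX => /(_ isT).
have /(size_poly_binom (k - i)) : (size (n%:R%:P - 'X : {poly R})%R <= 2)%N.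
  rewrite (leq_trans (size_polyD _ _)) // size_polyN size_polyX geq_max andbT.
  by rewrite (leq_trans (size_polyC_leq1 _)).
have := ltn_ord i; lia.
Qed.

Lemma coef_binomial_exp (c : R) m j :
  ((1 + c *: 'X) ^+ m : {poly R})`_j = c ^+ j * 'C(m, j)%:R.
Proof.
rewrite exprDn coef_sum; under eq_bigr => l _.
  rewrite expr1n mul1r exprZn coefMn coefZ coefXn; over.
have [jm|mj] := ltnP j m.+1; last first.
  rewrite bin_small // mulr0 big1 // => l _.
  by rewrite gtn_eqF ?mulr0 ?mul0rn // (leq_trans (ltn_ord l)).
rewrite (bigD1 (Ordinal jm)) //= eqxx mulr1 big1 ?addr0 ?mulr_natr // => l.
by rewrite -val_eqE /= eq_sym => /negPf->; rewrite mulr0 mul0rn.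
Qed.

(** At an integer [t <= n] the polynomial binomials are ordinary ones, and the defining sum is the
    Cauchy product of two binomial expansions. *)
Lemma krawtchouk_coef n k t : (t <= n)%N ->
  (krawtchouk R n k).[t%:R] =
    ((1 - 'X) ^+ t * (1 + 'X) ^+ (n - t) : {poly R})`_k.
Proof.
move=> tn; rewrite coefM /krawtchouk horner_sum; apply: eq_bigr => i _.
rewrite hornerZ hornerM (@horner_poly_binom _ _ t) ?hornerX //.
rewrite (@horner_poly_binom _ _ (n - t)); last by rewrite !hornerE natrB.
have := @coef_binomial_exp (-1) t i; rewrite scaleN1r => ->.
have := @coef_binomial_exp 1 (n - t)%N (k - i)%N; rewrite scale1r => ->.
by rewrite expr1n mul1r mulrA.
Qed.

Lemma krawtchouk_chi n k (z : cube n) :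
  (krawtchouk R n k).[(weight z)%:R] =
    \sum_(a : cube n | weight a == k) chi R a z.
Proof.
rewrite krawtchouk_coef ?weight_le // -sum_chi_weight.
by apply: eq_bigr => a _; rewrite chiC.
Qed.

(** As a function of the weight, the Krawtchouk polynomial is the sum of the characters of weight
    [k], each orthogonal to functions of degree below [k]. *)
Lemma krawtchouk_orthogonal n k p : (size p <= k)%N ->
  \sum_(z : cube n) (krawtchouk R n k).[(weight z)%:R] * p.[(weight z)%:R] = 0.
Proof.
case: k => [|k] pk.
  move: pk; rewrite leqn0 size_poly_eq0 => /eqP->.
  by rewrite big1 // => z _; rewrite horner0 mulr0.
under eq_bigr do rewrite krawtchouk_chi mulr_suml.
rewrite exchange_big big1 // => a /eqP ak.
rewrite -[RHS](degle_poly (n := n) pk (a := a)) ?ak //.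
by apply: eq_bigr => z _; rewrite mulrC.
Qed.

Lemma krawtchouk_at0 n k : (krawtchouk R n k).[0] = 'C(n, k)%:R.
Proof.
rewrite (krawtchouk_coef k (leq0n n)) expr0 mul1r subn0.
by rewrite -[X in 1 + X]scale1r coef_binomial_exp expr1n mul1r.
Qed.

(** The polynomial is positive at 0 and orthogonal to 1, hence nonpositive at some weight, and a
    real root lies in between. So the default value of [least_root] is not reached. *)
Lemma root_krawtchouk_root n k : (0 < k <= n)%N ->
  root (krawtchouk R n k) (krawtchouk_root R n k).
Proof.
move=> /andP[k0 kn].
have K0 : 0 < (krawtchouk R n k).[0] by rewrite krawtchouk_at0 ltr0n bin_gt0.
have Kn0 : krawtchouk R n k != 0.
  by apply: contraTneq K0 => ->; rewrite horner0 ltxx.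
have [z Kz] : exists z : cube n, (krawtchouk R n k).[(weight z)%:R] <= 0.
  apply/existsP; apply: contraPT (@krawtchouk_orthogonal n k 1 _).
    move=> /existsPn Kp; apply/eqP; rewrite gt_eqF //.
    rewrite (bigD1 [ffun=> false]) //= weight0 hornerC mulr1.
    rewrite ltr_wpDr // sumr_ge0 // => z _; rewrite hornerC mulr1 ltW //.
    by rewrite ltNge.
  by rewrite size_poly1.
have [|x _] := @poly_ivt _ (- krawtchouk R n k) 0 (weight z)%:R (ler0n _ _).
  by rewrite !hornerN oppr_le0 oppr_ge0 (ltW K0).
by rewrite rootN; exact: root_least_root.
Qed.

(* Divide the Krawtchouk polynomial by [X - xi], xi its least root, and use
   that it is orthogonal to the quotient. *)
Lemma ex_krawtchouk_root_weight n r : (r.+1 <= n)%N ->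
  exists u : {poly R}, [/\ (size u <= r.+1)%N,
    0 < \sum_(z : cube n) u.[(weight z)%:R] ^+ 2 &
    \sum_(z : cube n) (weight z)%:R * u.[(weight z)%:R] ^+ 2 =
    krawtchouk_root R n r.+1 * \sum_(z : cube n) u.[(weight z)%:R] ^+ 2].
Proof.
move=> rn; set xi := krawtchouk_root R n r.+1.
have /factor_theorem[u Ku] : root (krawtchouk R n r.+1) xi.
  exact: root_krawtchouk_root.
have K0 : (krawtchouk R n r.+1).[0] != 0.
  by rewrite krawtchouk_at0 pnatr_eq0 -lt0n bin_gt0.
have u0 : u.[0] != 0.
  by apply: contraNneq K0 => u0; rewrite Ku hornerM u0 mul0r.
have ur : (size u <= r.+1)%N.
  have := size_krawtchouk n r.+1.
  rewrite Ku size_Mmonic ?monicXsubC ?size_XsubC ?addn2 //.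
  by apply: contraNneq u0 => ->; rewrite horner0.
exists u; split=> //.
  rewrite (bigD1 [ffun=> false]) //= weight0 ltr_wpDr ?exprn_even_gt0 //.
  by apply: sumr_ge0 => z _; exact: sqr_ge0.
apply/eqP; rewrite -subr_eq0 mulr_sumr -sumrB; apply/eqP.
rewrite -[RHS](@krawtchouk_orthogonal n _ _ ur); apply: eq_bigr => z _.
by rewrite Ku !hornerE /=; ring.
Qed.

End KrawtchoukRoot.

(** The coefficients are recovered from the values at [d.+1] distinct points of [[0, 1)] by
    inverting a Vandermonde matrix that depends on [d] only. *)
Lemma ex_coef_bound (R : realType) (d : nat) : exists2 g : R, 0 <= g &
  forall (c : 'I_d.+1 -> R) (B : R),
    (forall t, -1 <= t <= 1 -> `|\sum_k c k * t ^+ k| <= B) ->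
    forall k, `|c k| <= g * B.
Proof.
pose t : 'rV[R]_d.+1 := \row_j (j%:R / d.+1%:R).
pose V := Vandermonde d.+1 t.
have Vu : V \in unitmx.
  rewrite unitmxE det_Vandermonde unitfE; apply/prodf_neq0 => i _.
  apply/prodf_neq0 => j ij.
  rewrite !mxE -mulrBl mulf_neq0 ?invr_eq0 ?pnatr_eq0 // subr_eq0 eqr_nat.
  by rewrite gtn_eqF.
(* Summing over all entries of the inverse gives one constant valid for every coefficient. *)
exists (\sum_j \sum_k `|invmx V j k|).
  by apply: sumr_ge0 => j _; apply: sumr_ge0.
move=> c B cB k.
have cE : \row_j c j = (\row_j c j *m V) *m invmx V by rewrite mulmxK.
have -> : c k = \sum_j (\sum_i c i * t 0 j ^+ i) * invmx V j k.
  transitivity ((\row_j c j) 0 k); first by rewrite mxE.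
  rewrite {1}cE mxE; apply: eq_bigr => j _; rewrite mxE; congr (_ * _).
  by apply: eq_bigr => i _; rewrite !mxE.
apply: le_trans (ler_norm_sum _ _ _) _; rewrite mulr_suml ler_sum // => j _.
rewrite normrM mulrC ler_pM //.
  rewrite (bigD1 k) //= lerDl; exact: sumr_ge0.
apply: cB; rewrite !mxE (le_trans _ (divr_ge0 _ _)) ?ler0n ?lerN10 //=.
by rewrite ler_pdivrMr ?ltr0n // mul1r ler_nat ltnW.
Qed.

(** * Homogeneous components, noise, and eigenvalues of convolutions *)

Section Harmonic.
Variables (R : realType) (n : nat).
Implicit Types (a x y z : cube n) (F w : cube n -> R).

(** The part of the Fourier expansion of [F] carried by the characters of weight [k]. *)
Definition component k F x : R :=
  (2 ^+ n)^-1 *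
    \sum_(a | weight a == k) chi R a x * \sum_(y : cube n) F y * chi R a y.

Lemma noise_component (d : nat) F (t : R) x : degle d F ->
  \sum_y F y * \prod_i (1 + t * (-1) ^+ (x i (+) y i)) =
  2 ^+ n * \sum_(k < d.+1) component k F x * t ^+ k.
Proof.
move=> dF; under eq_bigr do rewrite noise_chi mulr_sumr.
rewrite exchange_big mulr_sumr /=.
have -> : \sum_(k < d.+1) 2 ^+ n * (component k F x * t ^+ k) =
    \sum_(k < d.+1) \sum_a (if weight a == k then
      t ^+ weight a * (chi R a x * \sum_(y : cube n) F y * chi R a y) else 0).
  apply: eq_bigr => k _; rewrite /component -mulrA mulVKf ?expf_neq0 //.
  rewrite mulr_suml big_mkcond; apply: eq_bigr => a _.
  by case: eqP => // ->; rewrite mulrC.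
rewrite [RHS]exchange_big; apply: eq_bigr => a _ /=.
transitivity (t ^+ weight a * (chi R a x * \sum_(y : cube n) F y * chi R a y)).
  by rewrite !mulr_sumr; apply: eq_bigr => y _; ring.
have [ad|da] := ltnP (weight a) d.+1.
  rewrite (bigD1 (Ordinal ad)) //= eqxx [X in _ + X]big1 ?addr0 // => k.
  by rewrite -val_eqE /= eq_sym => /negPf->.
by rewrite dF // !mulr0 big1 // => k _; case: ifP.
Qed.

(** Fourier inversion, read off the noise identity at parameter 1, where the kernel vanishes away
    from [x]. *)
Lemma component_sum (d : nat) F x : degle d F ->
  F x = \sum_(k < d.+1) component k F x.
Proof.
move=> /(noise_component 1 x).
under [X in _ = _ * X]eq_bigr do rewrite expr1n mulr1.
rewrite (bigD1 x) //= [X in _ + X]big1 => [|y yx].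
  rewrite addr0 (eq_bigr (fun=> 2)) => [|i _]; last first.
    by rewrite addbb expr0 mulr1.
  rewrite prodr_const card_ord mulrC => /mulfI; apply.
  by rewrite expf_neq0.
have [i xyi] : exists i, x i != y i.
  apply/existsP; apply: contra_neqT yx => /existsPn xy.
  by apply/ffunP => i; move: (xy i); rewrite negbK => /eqP.
rewrite (bigD1 i) //= (_ : x i (+) y i = true) ?expr1 ?mulrN1 ?addrN ?mul0r ?mulr0 //.
by case: (x i) (y i) xyi => [] [].
Qed.

(* The sum is the average of F against the noise distribution with parameter t
   centered at x. *)
Lemma component_noise_bound (d : nat) F (B t : R) x :
  degle d F -> (forall y, `|F y| <= B) -> -1 <= t <= 1 ->
  `|\sum_(k < d.+1) component k F x * t ^+ k| <= B.
Proof.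
move=> dF FB /andP[t1 t2].
rewrite -(ler_pM2l (exprn_gt0 n (ltr0Sn R 1))) -{1}[2 ^+ n]ger0_norm ?exprn_ge0 //.
rewrite -normrM -(noise_component t x dF) -(sum_noise t x) mulr_suml.
apply: le_trans (ler_norm_sum _ _ _) _; apply: ler_sum => y _.
rewrite normrM mulrC [`|\prod_i _|]ger0_norm ?ler_wpM2l //; apply: prodr_ge0 => i _.
  by case: (_ (+) _); rewrite /= ?expr1 ?expr0; lra.
by case: (_ (+) _); rewrite /= ?expr1 ?expr0; lra.
Qed.

(** Characters are eigenfunctions of convolution, because [chi a y = chi a x * chi a (cadd x y)]. *)
Lemma component_conv w (lam : nat -> R) k F x :
  (forall a, \sum_z w z * chi R a z = lam (weight a)) ->
  \sum_y w (cadd x y) * component k F y = lam k * component k F x.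
Proof.
move=> wlam; rewrite /component mulrCA mulr_sumr.
under eq_bigr do rewrite mulrCA mulr_sumr.
rewrite -[LHS]mulr_sumr; congr (_ * _).
rewrite exchange_big; apply: eq_bigr => a /eqP <- /=.
under eq_bigr do rewrite mulrA; rewrite -mulr_suml mulrA; congr (_ * _).
rewrite -wlam mulr_suml -[RHS](sum_cadd _ x); apply: eq_bigr => y _ /=.
have x1 : chi R a x * chi R a x = 1.
  by rewrite -expr2 -real_normK ?num_real // normr_chi expr1n.
by rewrite chiDr -mulrA mulrAC x1 mul1r.
Qed.

Lemma radial_eigenvalue (phi : nat -> R) : exists lam : nat -> R,
  forall a, \sum_z phi (weight z) * chi R a z = lam (weight a).
Proof.
exists (fun k => \sum_(t < n.+1)
  phi t * ((1 - 'X) ^+ k * (1 + 'X) ^+ (n - k) : {poly R})`_t) => a.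
rewrite (partition_big (fun z => inord (weight z) : 'I_n.+1) predT) //=.
apply: eq_bigr => t _; rewrite -sum_chi_weight mulr_sumr.
apply: eq_big => [z|z /eqP<-]; last by rewrite inordK ?ltnS ?weight_le.
by rewrite -val_eqE /= inordK ?ltnS ?weight_le.
Qed.

Lemma onem_prod_le (I : finType) (e : I -> R) :
  (forall i, `|e i| <= 1) -> 1 - \prod_i e i <= \sum_i (1 - e i).
Proof.
(* The norm bound is carried along because the product step amounts to
   [0 <= (1 - p1) * (1 - p2)]. *)
move=> e1; suff [] : `|\prod_i e i| <= 1 /\ 1 - \prod_i e i <= \sum_i (1 - e i) by [].
elim/big_ind2 : _ => [|p1 s1 p2 s2 [n1 h1] [n2 h2]|i _].
- by rewrite normr1 subrr.
- split; first by rewrite normrM mulr_ile1.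
  move: n1 n2; rewrite !ler_norml => /andP[_ n1] /andP[_ n2]; nra.
- by [].
Qed.

Lemma ex_weight k : (k <= n)%N -> exists a, weight a = k.
Proof.
move=> kn; exists [ffun i : 'I_n => (i < k)%N].
rewrite /weight (eq_bigr (fun i : 'I_n => nat_of_bool (i < k)%N)) => [|i _].
  by rewrite -big_mkcond -(big_ord_widen _ (fun=> 1%N)) // sum1_card card_ord.
by rewrite ffunE.
Qed.

(** A character of weight [k] is a product of [k] characters of weight one, so [onem_prod_le],
    averaged against [w], gives [1 - lam k <= k * (1 - lam 1)]. *)
Lemma eigenvalue_bound w (lam : nat -> R) k : (0 < n)%N -> (k <= n)%N ->
  (forall z, 0 <= w z) -> \sum_z w z = 1 ->
  (forall a, \sum_z w z * chi R a z = lam (weight a)) ->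
  0 <= 1 - lam k <= 2 * k%:R * ((\sum_z (weight z)%:R * w z) / n%:R).
Proof.
move=> n0 kn w0 w1 wlam; have [a <-] := ex_weight kn.
have lamE b : 1 - lam (weight b) = \sum_z w z * (1 - chi R b z).
  by rewrite -{1}w1 -wlam -sumrB; apply: eq_bigr => z _; rewrite mulrBr mulr1.
apply/andP; split.
  by rewrite lamE sumr_ge0 // => z _; rewrite mulr_ge0 // subr_ge0 chi_le1.
(* All [n] characters of weight one share the eigenvalue [lam 1], and [1 - chi (delta i) z] is twice
   the bit [z i]. *)
have lam1 : n%:R * (1 - lam 1%N) = 2 * \sum_z (weight z)%:R * w z.
  rewrite mulr_natl -[X in _ *+ X]card_ord -sumr_const mulr_sumr.
  under eq_bigr => i _ do rewrite -(weight_delta i) lamE.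
  rewrite exchange_big; apply: eq_bigr => z _ /=.
  rewrite /weight natr_sum mulr_suml mulr_sumr; apply: eq_bigr => i _.
  by rewrite bit_chi; field.
rewrite (_ : _ * _ = (weight a)%:R * (1 - lam 1%N)); last first.
  apply: (mulfI (x := n%:R)); first by rewrite pnatr_eq0 -lt0n.
  by rewrite [RHS]mulrCA lam1; field; rewrite pnatr_eq0 -lt0n.
rewrite lamE /weight natr_sum mulr_suml.
rewrite [leRHS](_ : _ = \sum_z \sum_i w z * ((a i)%:R * (1 - chi R (delta i) z))).
  apply: ler_sum => z _; rewrite -mulr_sumr ler_wpM2l //.
  apply: le_trans (onem_prod_le _) _ => [i|].
    by rewrite normrX normrN1 expr1n.
  apply: ler_sum => i _; rewrite chi_delta.
  by case: (a i); rewrite /= ?mul1r // mul0r expr0 subrr.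
rewrite exchange_big; apply: eq_bigr => i _ /=.
rewrite -[X in lam X](weight_delta i) lamE mulr_sumr.
by apply: eq_bigr => z _; rewrite mulrCA.
Qed.

End Harmonic.

(** * Sums of squares obtained by convolution with a squared radial polynomial *)

Section SumsOfSquares.
Variables (R : realType) (n : nat).

Lemma msize_sum (I : Type) (s : seq I) (F : I -> {mpoly R[n]}) m :
  (forall i, msize (F i) <= m)%N -> (msize (\sum_(i <- s) F i)%R <= m)%N.
Proof.
move=> Fm; elim/big_ind : _ => // [|p q pm qm]; first by rewrite mmeasure0.
by rewrite (leq_trans (msizeD_le _ _)) // geq_max pm.
Qed.

Lemma msizeM_leS (p q : {mpoly R[n]}) i j :
  (msize p <= i.+1 -> msize q <= j.+1 -> msize (p * q)%R <= (i + j).+1)%N.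
Proof.
have [->|p0] := eqVneq p 0; first by rewrite mul0r mmeasure0.
have [->|q0] := eqVneq q 0; first by rewrite mulr0 mmeasure0.
rewrite msizeM // => pi qj; rewrite -subn1 leq_subLR add1n -addnS -addSn.
exact: leq_add.
Qed.

(** For fixed [y], the bit [x i (+) y i] is affine in [x i]. *)
Lemma ex_mpoly_dist (y : cube n) : exists2 q : {mpoly R[n]}, (msize q <= 2)%N &
  forall x, cube_eval q x = (weight (cadd x y))%:R.
Proof.
exists (\sum_i if y i then 1 - 'X_i else 'X_i).
  apply: msize_sum => i; have Xi : (msize ('X_i : {mpoly R[n]}) <= 2)%N.
    by rewrite msizeX mdeg1.
  case: (y i) => //; rewrite (leq_trans (msizeD_le _ _)) // geq_max mmeasureN Xi.
  by rewrite msize1.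
move=> x; rewrite /cube_eval raddf_sum /weight natr_sum; apply: eq_bigr => i _ /=.
rewrite ffunE; case: (y i) => /=; rewrite ?addbF ?mevalXU //.
by rewrite mevalB meval1 mevalXU addbT; case: (x i); rewrite ?subrr ?subr0.
Qed.

(** Each [y] contributes one square: [u] at the distance to [y], scaled by the square root of
    [g y]. *)
Lemma sos_conv (r : nat) (u : {poly R}) (g : cube n -> R) :
  (size u <= r.+1)%N -> (forall y, 0 <= g y) ->
  exists2 s : {mpoly R[n]}, sos r s &
    forall x, \sum_y u.[(weight (cadd x y))%:R] ^+ 2 * g y = cube_eval s x.
Proof.
move=> ur g0.
have /choice[p pP] (y : cube n) : exists q : {mpoly R[n]}, (msize q <= r.+1)%N /\
    forall x, cube_eval q x = Num.sqrt (g y) * u.[(weight (cadd x y))%:R].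
  have [q q2 qE] := ex_mpoly_dist y.
  exists (Num.sqrt (g y) *: \sum_(j < size u) u`_j *: q ^+ j); split=> [|x].
    apply: leq_trans (msizeZ_le _ _) _; apply: msize_sum => j.
    apply: leq_trans (msizeZ_le _ _) _.
    apply: leq_trans (leq_trans (ltn_ord j) ur).
    elim: (nat_of_ord j) => [|i IHi]; first by rewrite expr0 msize1.
    by rewrite exprS; exact: (@msizeM_leS _ _ 1 i).
  rewrite /cube_eval mevalZ raddf_sum horner_coef; congr (_ * _).
  by apply: eq_bigr => j _; rewrite /= mevalZ rmorphXn /= -qE.
exists (\sum_(q <- [seq p y | y <- index_enum (cube n)]) q ^+ 2).
  by exists [seq p y | y <- index_enum (cube n)] => // _ /mapP[y _ ->]; case: (pP y).
move=> x; rewrite big_map /cube_eval raddf_sum; apply: eq_bigr => y _ /=.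
have [_ py] := pP y; rewrite rmorphXn /= -/(cube_eval _ x) py exprMn sqr_sqrtr //.
exact: mulrC.
Qed.

End SumsOfSquares.

(** * The lower bound on [sos_bound] *)

Section SosBound.
Variables (R : realType) (n : nat).

Lemma cube_norm_ge (f : {mpoly R[n]}) x : `|cube_eval f x| <= cube_norm f.
Proof. exact: le_bigmax. Qed.

Lemma cube_min_le (f : {mpoly R[n]}) x : cube_min f <= cube_eval f x.
Proof. exact: bigmin_le. Qed.

Lemma le_sos_bound (r : nat) (f s : {mpoly R[n]}) (c : R) : sos r s ->
  (forall x, cube_eval f x - c = cube_eval s x) -> (c%:E <= sos_bound r f)%E.
Proof.
by move=> rs fs; apply: ereal_sup_ubound; exists c => //; exists s.
Qed.

(** The property of [g] is a premise so that a single [g], chosen before [n], serves every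
    dimension. *)
Lemma sos_bound_ge (d r : nat) (g : R) (f : {mpoly R[n]}) :
  (forall (c : 'I_d.+1 -> R) (B : R),
    (forall t, -1 <= t <= 1 -> `|\sum_k c k * t ^+ k| <= B) ->
    forall k, `|c k| <= g * B) ->
  (0 < n)%N -> (d <= n)%N -> (r.+1 <= n)%N -> (msize f <= d.+1)%N ->
  (d * d.+1)%:R * (krawtchouk_root R n r.+1 / n%:R) <= 1 / 2 ->
  ((cube_min f - 4 * (d * d.+1)%:R * g * (krawtchouk_root R n r.+1 / n%:R) *
     cube_norm f)%:E <= sos_bound r f)%E /\ 0 <= krawtchouk_root R n r.+1.
Proof.
move=> gP n0 dn rn fd.
have [u [ur]] := ex_krawtchouk_root_weight R rn.
set S := \sum_z _ ^+ 2; set xi := krawtchouk_root R n r.+1 => S0 uS.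
pose w (z : cube n) := u.[(weight z)%:R] ^+ 2 / S.
have w0 z : 0 <= w z by rewrite divr_ge0 ?sqr_ge0 // ltW.
have w1 : \sum_z w z = 1 by rewrite -mulr_suml mulfV // gt_eqF.
have wxi : \sum_z (weight z)%:R * w z = xi.
  by under eq_bigr do rewrite mulrA; rewrite -mulr_suml uS mulfK // gt_eqF.
have xi0 : 0 <= xi by rewrite -wxi sumr_ge0 // => z _; rewrite mulr_ge0.
set e := xi / n%:R => de; split=> //.
have e0 : 0 <= e by rewrite divr_ge0.
have [lam wlam] := radial_eigenvalue n (fun t => u.[t%:R] ^+ 2 / S).
have lamP (k : 'I_d.+1) : 2^-1 <= lam k <= 1 /\ 1 - lam k <= 2 * d%:R * e.
  have kd : (k <= d)%N by rewrite -ltnS.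
  have := eigenvalue_bound n0 (leq_trans kd dn) w0 w1 wlam.
  rewrite wxi -/e => /andP[l0 l1].
  have l2 : 1 - lam k <= 2 * d%:R * e.
    by apply: le_trans l1 _; rewrite ler_wpM2r // ler_wpM2l // ler_nat.
  (* Since [k <= d], [2 * k <= d * d.+1]; this is what keeps the eigenvalues at least one half. *)
  have l3 : 2 * k%:R * e <= 1 / 2.
    by apply: le_trans de; rewrite ler_wpM2r // -natrM ler_nat; nia.
  by split=> //; apply/andP; split; move: l1 l3; lra.
pose F := cube_eval f; pose N := cube_norm f.
have dF : degle d F := degle_cube_eval fd.
have compN (k : 'I_d.+1) x : `|component k F x| <= g * N.
  apply: (gP (fun k => component k F x)) => t t1; apply: component_noise_bound t1 => // y.
  exact: cube_norm_ge.
(* The preimage of [F] under convolution with [w]: each component is divided by its eigenvalue. *)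
pose h x := \sum_(k < d.+1) (lam k)^-1 * component k F x.
(* There are [d.+1] components of size at most [g * N], each multiplied by [(lam k)^-1 - 1 <= 2 * (1
   - lam k) <= 4 * d * e]. *)
have hF x : `|h x - F x| <= 4 * (d * d.+1)%:R * g * e * N.
  rewrite /h (component_sum x dF) -sumrB.
  apply: le_trans (ler_norm_sum _ _ _) _.
  rewrite [leRHS](_ : _ = \sum_(k < d.+1) 4 * d%:R * e * (g * N)); last first.
    by rewrite sumr_const card_ord -mulr_natr natrM; ring.
  apply: ler_sum => k _; rewrite -[X in _ - X]mul1r -mulrBl normrM.
  apply: ler_pM => //; have [/andP[l1 l2] l3] := lamP k.
  have l0 : 0 < lam k by apply: lt_le_trans l1; rewrite invr_gt0.
  have -> : (lam k)^-1 - 1 = (1 - lam k) / lam k by field; rewrite gt_eqF.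
  rewrite ger0_norm ?divr_ge0 ?subr_ge0 ?(ltW l0) // ler_pdivrMr //.
  apply: le_trans l3 _; have de0 : 0 <= d%:R * e by rewrite mulr_ge0.
  by move: l1; nra.
set B := 4 * _ * _ * _ * _ in hF *.
pose G y := h y - cube_min f + B.
have G0 y : 0 <= G y.
  move: (hF y) (cube_min_le f y); rewrite ler_norml => /andP[hF1 _] fmin.
  by rewrite /G; move: hF1 fmin; rewrite -/(F y); lra.
(* [sos_conv] uses the square of [u] without the normalization of [w], so [S] is moved into the
   averaged function. *)
have GS0 y : 0 <= G y / S by rewrite divr_ge0 // ltW.
have [s rs sE] := sos_conv ur GS0.
apply: (le_sos_bound rs) => x; rewrite -sE.
transitivity (\sum_y w (cadd x y) * G y); last first.
  by apply: eq_bigr => y _; rewrite /w; ring.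
have -> : \sum_y w (cadd x y) * G y =
    \sum_y w (cadd x y) * h y + \sum_y w (cadd x y) * (B - cube_min f).
  by rewrite -big_split; apply: eq_bigr => y _; rewrite /= /G; ring.
(* Constants are preserved because [w] has total mass one. *)
rewrite -[X in _ = _ + X]mulr_suml sum_cadd w1 mul1r.
suff -> : \sum_y w (cadd x y) * h y = F x by rewrite /F; ring.
under eq_bigr do rewrite /h mulr_sumr.
rewrite exchange_big (component_sum x dF); apply: eq_bigr => k _ /=.
under eq_bigr do rewrite mulrCA.
rewrite -mulr_sumr (component_conv _ _ _ wlam) mulKf //.
have [/andP[l1 _] _] := lamP k.
by rewrite gt_eqF // (lt_le_trans _ l1) // invr_gt0.
Qed.

End SosBound.

Theorem theorem1 (R : realType) (d : nat) :
  exists C : R, 0 < C /\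
    forall (n r : nat) (f : {mpoly R[n]}),
      (1 <= n)%N -> (d <= n)%N ->
      msize f = d.+1 ->
      (exists x : cube n, cube_eval f x != 0) ->
      r.+1%:R / n%:R <= 1 / 2 :> R ->
      (d * d.+1)%:R * (krawtchouk_root R n r.+1 / n%:R) <= 1 / 2 ->
      (((cube_min f)%:E - sos_bound r f) / (cube_norm f)%:E
        <= (2 * C * (krawtchouk_root R n r.+1 / n%:R))%:E)%E.
Proof.
have [g g0 gP] := ex_coef_bound R d.
(* Half of the constant in [sos_bound_ge], plus 1 to make it positive even when [d] is 0. *)
exists (2 * (d * d.+1)%:R * g + 1); split.
  by rewrite ltr_wpDl // mulr_ge0 ?mulr_ge0.
move=> n r f n1 dn fd [x fx] rn de.
have rn' : (r.+1 <= n)%N.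
  move: rn; rewrite ler_pdivrMr ?ltr0n // -(ler_nat R).
  have : 0 <= n%:R :> R by [].
  lra.
have fd' : (msize f <= d.+1)%N by rewrite fd.
have [lb xi0] := sos_bound_ge gP n1 dn rn' fd' de.
have N0 : 0 < cube_norm f.
  by apply: lt_le_trans (cube_norm_ge f x); rewrite normr_gt0.
rewrite inver gt_eqF // lee_pdivrMr // -EFinM.
apply: le_trans (leeB (lexx _) lb) _; rewrite -EFinB lee_fin.
rewrite subKr -subr_ge0.
set e := _ / _; have e0 : 0 <= e by rewrite divr_ge0.
have := mulr_ge0 e0 (ltW N0); lra.
Qed.
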